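(* Let $(\mathsf{V}_n)_{n\ge 0}$, with $\mathsf{V}_0=\mathsf{H}^2(\mathbb{T})$, be a decreasing sequence of invariant subspaces of $\mathsf{H}^2(\mathbb{T})$, and let $\mathsf{V}_\infty=\bigcap_{n\ge 0}\mathsf{V}_n$. For $n\in\{0,1,2,\dots\}\cup\{\infty\}$ let $\mathcal{P}_n$ be the projection operator associated with $\mathsf{V}_n$ (as defined in the context). Then, for all $p\in(1,+\infty)$ and all $f\in\mathsf{H}^p(\mathbb{T})$, $$\lim_{n\to+\infty}\|\mathcal{P}_nf-\mathcal{P}_\infty f\|_p=0 .$$
   Context: $\mathbb{T}$ is the unit circle with normalized measure $\mathrm{d}\theta/2\pi$. For $p\ge1$, $\mathsf{H}^p(\mathbb{T})$ is the Hardy space of analytic functions on the unit disk with $\sup_{0<r<1}\int_0^{2\pi}|f(re^{i\theta})|^p\frac{\mathrm{d}\theta}{2\pi}<\infty$, identified through boundary values with the functions in $L^p(\mathbb{T})$ whose Fourier coefficients of negative order vanish. An inner function is a bounded analytic function on the unit disk whose boundary values have modulus $1$ almost everywhere. An invariant subspace of $\mathsf{H}^2(\mathbb{T})$ is a closed linear subspace stable under multiplication by $z=e^{i\theta}$; if nonzero it has the form $u\,\mathsf{H}^2(\mathbb{T})$ with $u$ inner (unique up to a unimodular constant). The orthogonal projection $H$ of $L^2(\mathbb{T})$ onto $\mathsf{H}^2(\mathbb{T})$ extends to a bounded operator from $L^p(\mathbb{T})$ to $\mathsf{H}^p(\mathbb{T})$ for $1<p<\infty$. For $u$ inner, the operator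 associated with $u$ (or with the subspace $u\,\mathsf{H}^2(\mathbb{T})$) is $H_u: f\mapsto u\,H(u^{-1}f)$; on $L^2$ it is the orthogonal projection onto $u\,\mathsf{H}^2(\mathbb{T})$, and it is bounded from $L^p(\mathbb{T})$ to $\mathsf{H}^p(\mathbb{T})$ for every $p\in(1,\infty)$. For an invariant subspace $\mathsf{V}=u\,\mathsf{H}^2(\mathbb{T})$ the associated projection operator is $H_u$; for $\mathsf{V}=\{0\}$ it is the zero operator. $\|\cdot\|_p$ is the $L^p(\mathbb{T})$ norm. *)

(* Defs.v *)
From HB Require Import structures.
From mathcomp Require Import all_boot all_order all_algebra.
From mathcomp Require Import all_classical all_reals all_analysis.
From mathcomp Require Import complex.
Set Implicit Arguments.
Unset Strict Implicit.
Unset Printing Implicit Defensive.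
Import Order.TTheory GRing.Theory Num.Theory.
Import numFieldNormedType.Exports.
Local Open Scope classical_set_scope.
Local Open Scope ring_scope.
Local Open Scope complex_scope.

(* A function on the unit circle is represented by a function of the angle
   [t : R], the point being [exp (i t)]. Only its values on [0, 2 pi] matter, up
   to almost everywhere equality for the measure [circle_prob]. *)

Lemma two_pi_gt0 (R : realType) : (0 : R) < pi *+ 2.
Proof. by rewrite mulrn_wgt0 ?pi_gt0. Qed.

Definition circle_prob (R : realType) : probability (measurableTypeR R) R :=
  uniform_prob (two_pi_gt0 R).

Definition expi (R : realType) (t : R) : R[i] := cos t +i* sin t.

Definition cintegral (R : realType) (f : R -> R[i]) : R[i] :=
  (\int[circle_prob R]_t complex.Re (f t)) +i*
  (\int[circle_prob R]_t complex.Im (f t)).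

Definition cmeasurable (R : realType) (f : R -> R[i]) : Prop :=
  measurable_fun [set: R] (fun t => complex.Re (f t)) /\
  measurable_fun [set: R] (fun t => complex.Im (f t)).

Definition normLp (R : realType) (p : R) (f : R -> R[i]) : \bar R :=
  Lnorm (circle_prob R) p%:E (fun t => (ComplexField.Normc.normc (f t))%:E).

Definition Lp (R : realType) (p : R) : set (R -> R[i]) :=
  [set f | cmeasurable f /\ (normLp p f < +oo)%E].

Definition inner_prod (R : realType) (f g : R -> R[i]) : R[i] :=
  cintegral (fun t => f t * (g t)^*).

Definition fourier_coef (R : realType) (f : R -> R[i]) (k : int) : R[i] :=
  cintegral (fun t => f t * expi (- (k%:~R * t))).

(* The Hardy space, seen through boundary values as a subspace of [Lp]. *)
Definition Hp (R : realType) (p : R) : set (R -> R[i]) :=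
  [set f | Lp p f /\ forall k : int, k < 0 -> fourier_coef f k = 0].

(* [u] is the boundary function (radial limit) of an inner function [F];
   derivability over the field [R[i]] is complex differentiability. *)
Definition inner_fun (R : realType) (u : R -> R[i]) : Prop :=
  cmeasurable u /\
  exists F : R[i]^o -> R[i]^o,
    [/\ forall z : R[i]^o, `|z| < 1 -> derivable F z 1,
        exists M : R[i], forall z : R[i]^o, `|z| < 1 -> `|F z| <= M,
        {ae circle_prob R, forall t,
          F (r%:C * expi t) @[r --> (1 : R)^'-] --> (u t : R[i]^o)} &
        {ae circle_prob R, forall t, `|u t| = 1}].

(* [H] is the orthogonal projection of L^2 onto H^2, extended to a bounded
   linear operator from L^p to H^p for all 1 < p < oo. As L^q is included in L^p
   for p <= q, this is a single operator on the union of the L^p, 1 < p. *)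
Definition riesz_projection (R : realType)
    (H : (R -> R[i]) -> R -> R[i]) : Prop :=
  [/\ forall f, Lp 2 f ->
        Hp 2 (H f) /\
        forall g, Hp 2 g -> inner_prod (fun t => f t - H f t) g = 0,
      forall (p : R) (a : R[i]) f g, 1 < p -> Lp p f -> Lp p g ->
        {ae circle_prob R, forall t,
          H (fun s => a * f s + g s) t = a * H f t + H g t} &
      forall p : R, 1 < p -> exists M : R, forall f, Lp p f ->
        Hp p (H f) /\ (normLp p (H f) <= M%:E * normLp p f)%E].

Definition inner_projection (R : realType) (H : (R -> R[i]) -> R -> R[i])
    (u f : R -> R[i]) : R -> R[i] :=
  fun t => u t * H (fun s => (u s)^-1 * f s) t.

(* A subset of [Lp 2] closed for the L^2 seminorm is saturated for almost
   everywhere equality, i.e. it is a set of classes of functions. *)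
Definition invariant_subspace (R : realType) (V : set (R -> R[i])) : Prop :=
  [/\ V `<=` Hp 2,
      V (fun=> 0) /\
      (forall (a : R[i]) f g, V f -> V g -> V (fun t => a * f t + g t)),
      forall f, Lp 2 f ->
        (forall e : R, 0 < e ->
          exists2 g, V g & (normLp 2 (fun t => f t - g t)%R < e%:E)%E) ->
        V f &
      forall f, V f -> V (fun t => expi t * f t)].

Definition zero_subspace (R : realType) : set (R -> R[i]) :=
  [set f | cmeasurable f /\ {ae circle_prob R, forall t, f t = 0}].

Definition inner_multiples (R : realType) (u : R -> R[i]) : set (R -> R[i]) :=
  [set f | cmeasurable f /\
     exists2 h, Hp 2 h & {ae circle_prob R, forall t, f t = u t * h t}].

(* [P] is the operator associated with the invariant subspace [V]. An inner [u]
   with [V = u H^2] exists for every nonzero [V] by Beurling's theorem; it is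
   unique up to a unimodular constant, which does not affect the operator
   (up to almost everywhere equality). *)
Definition associated_projection (R : realType)
    (H : (R -> R[i]) -> R -> R[i]) (V : set (R -> R[i]))
    (P : (R -> R[i]) -> R -> R[i]) : Prop :=
  (V = @zero_subspace R /\ forall f, P f = fun=> 0) \/
  exists u : R -> R[i],
    [/\ inner_fun u, V = inner_multiples u &
        forall f, P f = inner_projection H u f].

(* Main.v *)
(* The operator attached to [u H^2] is the Riesz projection preceded by
   multiplication by [u^-1] and followed by multiplication by [u]. As [u] has
   modulus 1, its L^p operator norm is bounded independently of [u], and on L^2
   it is the orthogonal projection onto [u H^2]. On L^2, Pythagoras and
   completeness give the strong convergence of the projections onto a decreasing
   sequence of closed subspaces. For bounded [f], convergence in L^2 gives
   convergence in L^p: directly when [p <= 2], and by Cauchy-Schwarz, in the form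
   [|x|_p^p <= |x|_2 |x|_(2p-2)^(p-1)], when [p > 2]. Bounded functions are dense
   in L^p, and the uniform bound concludes. *)
Require Import Defs.
From mathcomp Require Import all_boot all_order all_algebra.
From mathcomp Require Import all_classical all_reals all_analysis.
From mathcomp Require Import measurable_realfun.
From mathcomp Require Import complex ring lra.
Set Implicit Arguments.
Unset Strict Implicit.
Unset Printing Implicit Defensive.
Import Order.TTheory GRing.Theory Num.Theory.
Import numFieldNormedType.Exports.
Local Open Scope classical_set_scope.
Local Open Scope ring_scope.

Local Notation normc := (@ComplexField.Normc.normc _).
Local Notation Re := (@complex.Re _).
Local Notation Im := (@complex.Im _).

(** * Real part, imaginary part and modulus of complex numbers *)

Section ComplexNorm.
Context {R : realType}.
Implicit Types z w : R[i].

Lemma normc_ge0 z : 0 <= normc z.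
Proof. by case: z => a b; exact: sqrtr_ge0. Qed.

Lemma sqr_normcE z : normc z ^+ 2 = Re z ^+ 2 + Im z ^+ 2.
Proof. by case: z => a b; rewrite sqr_sqrtr// addr_ge0// sqr_ge0. Qed.

Lemma complexReD z w : Re (z + w) = Re z + Re w.
Proof. by case: z; case: w. Qed.

Lemma complexImD z w : Im (z + w) = Im z + Im w.
Proof. by case: z; case: w. Qed.

Lemma complexReM z w : Re (z * w) = Re z * Re w - Im z * Im w.
Proof. by case: z; case: w. Qed.

Lemma complexImM z w : Im (z * w) = Re z * Im w + Im z * Re w.
Proof. by case: z; case: w. Qed.

Lemma complexReJ z : Re (conjc z) = Re z.
Proof. by case: z. Qed.

Lemma complexImJ z : Im (conjc z) = - Im z.
Proof. by case: z. Qed.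

Lemma complexReN z : Re (- z) = - Re z.
Proof. by case: z. Qed.

Lemma complexImN z : Im (- z) = - Im z.
Proof. by case: z. Qed.

Lemma normr_Re_le_normc z : `|Re z| <= normc z.
Proof.
rewrite -(@ler_pXn2r _ 2)// ?nnegrE ?normc_ge0//.
by rewrite real_normK ?num_real// sqr_normcE lerDl sqr_ge0.
Qed.

Lemma normr_Im_le_normc z : `|Im z| <= normc z.
Proof.
rewrite -(@ler_pXn2r _ 2)// ?nnegrE ?normc_ge0//.
by rewrite real_normK ?num_real// sqr_normcE lerDr sqr_ge0.
Qed.

Lemma normc_le z : normc z <= `|Re z| + `|Im z|.
Proof.
rewrite -(@ler_pXn2r _ 2)// ?nnegrE ?normc_ge0 ?addr_ge0//.
rewrite sqr_normcE sqrrD !real_normK ?num_real// lerD2r lerDl.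
by rewrite mulrn_wge0// mulr_ge0.
Qed.

Lemma normc_normr z : `|z| = 1 -> normc z = 1.
Proof. by rewrite normc_def => -[]; case: z. Qed.

Lemma conj_invc z : normc z = 1 -> Num.conj z = z^-1.
Proof.
case: z => a b /= /(congr1 (fun x => x ^+ 2)).
rewrite expr1n sqr_sqrtr ?addr_ge0 ?sqr_ge0// /GRing.inv /= => ->.
by rewrite !divr1.
Qed.

End ComplexNorm.

(** * Measurability of complex-valued functions *)

Section ComplexMeasurable.
Context {R : realType}.
Implicit Types f g : R -> R[i].

Lemma cmeasurable_cst (a : R[i]) : cmeasurable (fun _ : R => a).
Proof. by split; exact: measurable_cst. Qed.

Lemma cmeasurableD f g : cmeasurable f -> cmeasurable g ->
  cmeasurable (fun t => f t + g t).
Proof.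
move=> [fr fi] [gr gi]; split.
  by under eq_fun do rewrite complexReD; exact: measurable_funD.
by under eq_fun do rewrite complexImD; exact: measurable_funD.
Qed.

Lemma cmeasurableM f g : cmeasurable f -> cmeasurable g ->
  cmeasurable (fun t => f t * g t).
Proof.
move=> [fr fi] [gr gi]; split.
  under eq_fun do rewrite complexReM.
  by apply: measurable_funB; exact: measurable_funM.
under eq_fun do rewrite complexImM.
by apply: measurable_funD; exact: measurable_funM.
Qed.

Lemma cmeasurableN f : cmeasurable f -> cmeasurable (fun t => - f t).
Proof.
move=> [fr fi]; split.
  by under eq_fun do rewrite complexReN; exact: measurableT_comp.
by under eq_fun do rewrite complexImN; exact: measurableT_comp.
Qed.

Lemma cmeasurableB f g : cmeasurable f -> cmeasurable g ->
  cmeasurable (fun t => f t - g t).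
Proof. by move=> mf mg; apply: cmeasurableD => //; exact: cmeasurableN. Qed.

Lemma cmeasurableJ f : cmeasurable f -> cmeasurable (fun t => conjc (f t)).
Proof.
move=> [fr fi]; split; first by under eq_fun do rewrite complexReJ.
by under eq_fun do rewrite complexImJ; exact: measurableT_comp.
Qed.

Lemma measurable_normc f : cmeasurable f ->
  measurable_fun [set: R] (fun t => normc (f t)).
Proof.
move=> [fr fi].
have -> : (fun t => normc (f t)) =
    (fun t => Num.sqrt (Re (f t) ^+ 2 + Im (f t) ^+ 2)).
  by apply/funext => t; case: (f t).
(* The square root is written as a power, so that measurability of [powR] applies. *)
under eq_fun do rewrite -powR12_sqrt ?addr_ge0 ?sqr_ge0//.
apply: (measurableT_comp (measurable_powR _)).
by apply: measurable_funD; exact: measurable_funX.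
Qed.

Lemma cmeasurableV f : cmeasurable f -> cmeasurable (fun t => (f t)^-1).
Proof.
move=> [fr fi].
have mq : measurable_fun [set: R] (fun t => (Re (f t) ^+ 2 + Im (f t) ^+ 2)^-1).
  under eq_fun do rewrite -powR_inv1 ?addr_ge0 ?sqr_ge0//.
  apply: (measurableT_comp (measurable_powR _)).
  by apply: measurable_funD; exact: measurable_funX.
split.
  have -> : (fun t => Re (f t)^-1) =
      (fun t => Re (f t) / (Re (f t) ^+ 2 + Im (f t) ^+ 2)).
    by apply/funext => t; case: (f t).
  exact: measurable_funM.
have -> : (fun t => Im (f t)^-1) =
    (fun t => - (Im (f t) / (Re (f t) ^+ 2 + Im (f t) ^+ 2))).
  by apply/funext => t; case: (f t) => a b/=.
by apply: measurableT_comp => //; exact: measurable_funM.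
Qed.

End ComplexMeasurable.

(** * L^p norms and L^p spaces on the circle *)

Lemma ae_le_Lnorm {d} {T : measurableType d} {R : realType}
    (mu : {measure set T -> \bar R}) (p : R) (a b : T -> R) :
  0 < p -> measurable_fun [set: T] a -> measurable_fun [set: T] b ->
  {ae mu, forall x, `|a x| <= `|b x|} ->
  (Lnorm mu p%:E (EFin \o a) <= Lnorm mu p%:E (EFin \o b))%E.
Proof.
move=> p0 ma mb ab; rewrite unlock.
have mpow (h : T -> R) : measurable_fun [set: T] h ->
    measurable_fun [set: T] (fun x => (`|(EFin \o h) x| `^ p)%E).
  move=> mh; apply: (measurableT_comp (measurable_poweR p)).
  by apply: measurableT_comp => //; exact/measurable_EFinP.
apply: gt0_ler_poweR.
- by rewrite invr_ge0 ltW.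
- by rewrite in_itv/= leey andbT integral_ge0// => x _; exact: poweR_ge0.
- by rewrite in_itv/= leey andbT integral_ge0// => x _; exact: poweR_ge0.
apply: ae_ge0_le_integral => //; [|exact: mpow| |exact: mpow|].
- by move=> x _; exact: poweR_ge0.
- by move=> x _; exact: poweR_ge0.
apply: filterS ab => x abx _ /=.
by rewrite lee_fin ge0_ler_powR ?nnegrE ?(ltW p0).
Qed.

Section LpNorm.
Context {R : realType}.
Implicit Types (p q : R) (f g h : R -> R[i]).
Local Notation mu := (circle_prob R).

Lemma circle_aeS (P Q : R -> Prop) : {ae mu, forall t, P t} ->
  (forall t, P t -> Q t) -> {ae mu, forall t, Q t}.
Proof. move=> h PQ.
exact: (@filterS _ _ (ae_filter_ringOfSetsType mu) _ _ PQ h). Qed.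

Lemma circle_aeS2 (P Q S : R -> Prop) : {ae mu, forall t, P t} ->
  {ae mu, forall t, Q t} -> (forall t, P t -> Q t -> S t) ->
  {ae mu, forall t, S t}.
Proof. move=> hp hq PQS.
exact: (@filterS2 _ _ (ae_filter_ringOfSetsType mu) _ _ _ PQS hp hq). Qed.

Lemma normLp_ge0 p f : (0 <= normLp p f)%E.
Proof. exact: Lnorm_ge0. Qed.

Lemma ae_le_normLp p f g : 0 < p -> cmeasurable f -> cmeasurable g ->
  {ae mu, forall t, normc (f t) <= normc (g t)} ->
  (normLp p f <= normLp p g)%E.
Proof.
move=> p0 mf mg fg.
apply: (@ae_le_Lnorm _ _ _ mu p (normc \o f) (normc \o g)) => //;
  [exact: measurable_normc|exact: measurable_normc|].
by apply: (circle_aeS fg) => t; rewrite !ger0_norm ?normc_ge0.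
Qed.

Lemma ae_eq_normc_normLp p f g : 0 < p -> cmeasurable f -> cmeasurable g ->
  {ae mu, forall t, normc (f t) = normc (g t)} -> normLp p f = normLp p g.
Proof.
move=> p0 mf mg fg; apply/eqP; rewrite eq_le.
by apply/andP; split; apply: ae_le_normLp => //; apply: (circle_aeS fg) => t ->.
Qed.

Lemma ae_eq_normLp p f g : 0 < p -> cmeasurable f -> cmeasurable g ->
  {ae mu, forall t, f t = g t} -> normLp p f = normLp p g.
Proof.
move=> p0 mf mg fg; apply: ae_eq_normc_normLp => //.
by apply: (circle_aeS fg) => t ->.
Qed.

Lemma normLpD p f g : 1 <= p -> cmeasurable f -> cmeasurable g ->
  (normLp p (fun t => (f t + g t)%R) <= normLp p f + normLp p g)%E.
Proof.
move=> p1 mf mg; have p0 : 0 < p by exact: lt_le_trans p1.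
have mn := measurable_normc.
have := minkowski_EFin mu (mn _ _ mf) (mn _ _ mg) p1.
apply: le_trans.
apply: (@ae_le_Lnorm _ _ _ mu p (fun t => normc (f t + g t))
  (fun t => normc (f t) + normc (g t))) => //.
- by apply: (measurable_normc (f := fun t => f t + g t)); exact: cmeasurableD.
- by apply: measurable_funD; exact: mn.
apply/aeW => t.
rewrite ger0_norm ?normc_ge0// ger0_norm ?addr_ge0 ?normc_ge0//.
exact: le_normcD.
Qed.

Lemma normLp_subC p f g :
  normLp p (fun t => f t - g t) = normLp p (fun t => g t - f t).
Proof.
rewrite /normLp; congr Lnorm; apply/funext => t; congr EFin.
by rewrite -[LHS]normcN opprB.
Qed.

Lemma normLp_sub_le p f g h : 1 <= p ->
  cmeasurable f -> cmeasurable g -> cmeasurable h ->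
  (normLp p (fun t => (f t - h t)%R) <=
   normLp p (fun t => (f t - g t)%R) + normLp p (fun t => (g t - h t)%R))%E.
Proof.
move=> p1 mf mg mh.
have -> : (fun t => f t - h t) = (fun t => (f t - g t) + (g t - h t)).
  by apply/funext => t; rewrite addrA subrK.
by apply: normLpD => //; exact: cmeasurableB.
Qed.

Lemma normLpE p f : p != 0 ->
  (normLp p f `^ p = \int[mu]_t (normc (f t) `^ p)%:E)%E.
Proof.
move=> p0; rewrite /normLp poweR_Lnorm//; apply: eq_integral => t _.
by rewrite /= ger0_norm ?normc_ge0.
Qed.

Lemma normc_Lfun p f : cmeasurable f ->
  (normLp p f < +oo)%E = ((normc \o f) \in Lfun mu p%:E).
Proof.
move=> mf; rewrite inE; apply/idP/andP => [fp|[_]]; last by rewrite inE.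
by rewrite !inE; split => //; exact: measurable_normc.
Qed.

Lemma Lp_dominated p f g : 0 < p -> cmeasurable f -> Lp p g ->
  {ae mu, forall t, normc (f t) <= normc (g t)} -> Lp p f.
Proof.
move=> p0 mf [mg gp] fg; split => //.
by apply: le_lt_trans gp; exact: ae_le_normLp.
Qed.

Lemma LpD p f g : 1 <= p -> Lp p f -> Lp p g -> Lp p (fun t => f t + g t).
Proof.
move=> p1 [mf fp] [mg gp]; split; first exact: cmeasurableD.
by apply: le_lt_trans (normLpD p1 mf mg) _; rewrite lte_add_pinfty.
Qed.

Lemma LpN p f : Lp p f -> Lp p (fun t => - f t).
Proof.
move=> [mf fp]; split; first exact: cmeasurableN.
rewrite (_ : normLp _ _ = normLp p f)// /normLp; congr Lnorm.
by apply/funext => t; rewrite normcN.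
Qed.

Lemma LpB p f g : 1 <= p -> Lp p f -> Lp p g -> Lp p (fun t => f t - g t).
Proof. by move=> p1 lf lg; apply: LpD => //; exact: LpN. Qed.

(** The constant [M] dominates [f] and lies in every L^p, the measure being finite. *)
Lemma Lp_bounded p f (M : R) : 1 <= p -> cmeasurable f ->
  (forall t, normc (f t) <= M) -> Lp p f.
Proof.
move=> p1 mf fM; have M0 : 0 <= M by exact: le_trans (normc_ge0 (f 0)) (fM 0).
have p0 : 0 < p by exact: lt_le_trans p1.
have mM := @cmeasurable_cst R M%:C%C.
apply: (@Lp_dominated p f (fun=> M%:C%C)) => //.
  split => //; rewrite normc_Lfun//.
  rewrite [X in X \in _](_ : _ = cst M); first exact: (Lfun_cst mu).
  by apply/funext => t/=; rewrite expr0n addr0 sqrtr_sqr ger0_norm.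
by apply/aeW => t /=; rewrite expr0n addr0 sqrtr_sqr ger0_norm.
Qed.

(** Multiplication by [u] leaves the modulus unchanged almost everywhere. This is what makes the
    later operator bounds independent of the inner function. *)
Lemma Lp_unimodularM p u f : 0 < p -> cmeasurable u ->
  {ae mu, forall t, normc (u t) = 1} -> Lp p f ->
  Lp p (fun t => u t * f t) /\ normLp p (fun t => u t * f t) = normLp p f.
Proof.
move=> p0 mu_ u1 [mf fp].
have muf := cmeasurableM mu_ mf.
have e : {ae mu, forall t, normc (u t * f t) = normc (f t)}.
  by apply: (circle_aeS u1) => t ut; rewrite ComplexField.Normc.normcM ut mul1r.
have E := ae_eq_normc_normLp p0 muf mf e.
by split => //; split => //; rewrite E.
Qed.

End LpNorm.

(** * Hölder inequalities for a probability measure *)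

Section LnormProbability.
Context {d} {T : measurableType d} {R : realType} (P : probability T R).
Implicit Types (p q : R) (a : T -> R).

Let LnormE p (f : T -> \bar R) :
  Lnorm P p%:E f = ((\int[P]_x (`|f x| `^ p)) `^ p^-1)%E.
Proof. by rewrite unlock. Qed.

(** Hölder's inequality for [|a|^p] and the constant 1, with exponent [r = q / p] and its conjugate
    [r']. The constant has norm 1 because the total mass is 1. *)
Lemma le_Lnorm_probability p q a : 0 < p -> p <= q ->
  measurable_fun [set: T] a ->
  (Lnorm P p%:E (EFin \o a) <= Lnorm P q%:E (EFin \o a))%E.
Proof.
move=> p0; rewrite le_eqVlt => /predU1P[->//|pq] ma.
have q0 : 0 < q by exact: lt_trans pq.
pose r := q / p; pose r' := (1 - r^-1)^-1.
have r0 : 0 < r by rewrite divr_gt0.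
have r'0 : 0 < r'.
  by rewrite invr_gt0 subr_gt0 /r invf_div ltr_pdivrMr// mul1r.
have rr'1 : r^-1 + r'^-1 = 1 by rewrite /r' invrK subrKC.
have map : measurable_fun [set: T] (fun x => `|a x| `^ p).
  by apply: (measurableT_comp (measurable_powR p)); exact: measurableT_comp.
have := hoelder P map (measurable_cst (1 : R)) r0 r'0 rr'1.
have -> : ((fun x => `|a x| `^ p) \* cst 1)%R = (fun x => `|a x| `^ p).
  by apply/funext => x /=; rewrite mulr1.
rewrite (_ : EFin \o cst (1:R) = cst 1%E)// Lnorm_cst1.
rewrite [X in (_ * (X `^ _))%E](_ : _ = 1%E); last exact: probability_setT.
rewrite poweR1r mule1.
rewrite Lnorm1 => h.
rewrite [leLHS]LnormE [leRHS]LnormE.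
have -> : q^-1 = r^-1 * p^-1 by rewrite /r invf_div mulrAC mulfV ?mul1r ?gt_eqF.
rewrite poweRrM; apply: gt0_ler_poweR.
- by rewrite invr_ge0 ltW.
- by rewrite in_itv/= leey andbT integral_ge0// => x _; exact: poweR_ge0.
- by rewrite in_itv/= leey andbT poweR_ge0.
apply: le_trans (le_trans h _).
  by under [leRHS]eq_integral do rewrite /= ger0_norm ?powR_ge0//.
rewrite LnormE; under eq_integral => x _.
  rewrite /= ger0_norm ?powR_ge0// -powRrM (_ : p * r = q); last first.
    by rewrite /r mulrCA mulfV ?mulr1 ?gt_eqF.
  over.
by [].
Qed.

(** Cauchy-Schwarz for the factorisation of [|a|^p] as [|a|] times [|a|^(p-1)]. *)
Lemma Lnorm_interpolation p a : 1 < p -> measurable_fun [set: T] a ->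
  (Lnorm P p%:E (EFin \o a) `^ p <=
   Lnorm P 2%:E (EFin \o a) *
   Lnorm P (2 * (p - 1))%:E (EFin \o a) `^ (p - 1))%E.
Proof.
move=> p1 ma; have p0 : 0 < p by exact: lt_trans p1.
have q0 : 0 < p - 1 by rewrite subr_gt0.
have map : measurable_fun [set: T] (fun x => `|a x| `^ (p - 1)).
  apply: (measurableT_comp (measurable_powR (p - 1))).
  exact: measurableT_comp.
have := @hoelder _ _ _ P a _ 2 2 ma map (ltr0n _ 2) (ltr0n _ 2).
have -> : 2^-1 + 2^-1 = 1 :> R by rewrite [RHS]splitr !div1r.
move=> /(_ erefl); rewrite Lnorm1 poweR_Lnorm ?gt_eqF// => h.
apply: le_trans (le_trans h _).
  under [leRHS]eq_integral do rewrite /= normrM (ger0_norm (powR_ge0 _ _)).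
  apply: ge0_le_integral => //.
  - by move=> x _; exact: poweR_ge0.
  - apply: (measurableT_comp (measurable_poweR p)).
    by apply: measurableT_comp => //; exact/measurable_EFinP.
  - apply/measurable_EFinP; apply: measurable_funM => //.
    exact: measurableT_comp.
  - move=> x _ /=; rewrite lee_fin.
    have [->|ax] := eqVneq `|a x| 0; first by rewrite powR0 ?gt_eqF// mul0r.
    have ax0 : 0 < `|a x| by rewrite lt_def ax normr_ge0.
    rewrite -[X in _ <= X * _](powRr1 (normr_ge0 (a x))).
    by rewrite -powRD ?ax ?implybT// subrKC.
apply: lee_wpmul2l; first exact: Lnorm_ge0.
rewrite [leLHS]LnormE [X in (_ <= X `^ _)%E]LnormE -poweRrM.
have -> : (2 * (p - 1))^-1 * (p - 1) = 2^-1.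
  by rewrite invfM mulrAC -mulrA mulfV ?mulr1 ?gt_eqF.
apply: gt0_ler_poweR.
- by rewrite invr_ge0.
- by rewrite in_itv/= leey andbT integral_ge0// => x _; exact: poweR_ge0.
- by rewrite in_itv/= leey andbT integral_ge0// => x _; exact: poweR_ge0.
under eq_integral => x _.
  rewrite /= (ger0_norm (powR_ge0 _ _)) -powRrM mulrC.
  over.
by [].
Qed.

End LnormProbability.

(** * Almost everywhere convergence and completeness of L^p *)

(** The sum of the [|a (k+1) - a k|] has integral at most 1, hence is finite almost everywhere. At
    such a point the telescoping series converges absolutely. *)
Lemma ae_is_cvgn_of_L1_steps {d} {T : measurableType d} {R : realType}
    (mu : {measure set T -> \bar R}) (a : nat -> T -> R) :
  (forall k, measurable_fun [set: T] (a k)) ->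
  (forall k, (\int[mu]_x (`|a k.+1 x - a k x|)%:E <=
              (1 / (2 ^ k.+1)%:R)%:E)%E) ->
  {ae mu, forall x, cvgn (a ^~ x)}.
Proof.
move=> ma step.
pose D k x := (`|a k.+1 x - a k x|)%:E.
have D0 k x : (0 <= D k x)%E by rewrite lee_fin.
have mD k : measurable_fun [set: T] (D k).
  apply/measurable_EFinP; apply: measurableT_comp => //.
  exact: measurable_funB.
have S0 x : (0 <= \sum_(k <oo) D k x)%E by apply: nneseries_ge0.
have int_S : mu.-integrable [set: T] (fun x => \sum_(k <oo) D k x)%E.
  apply/integrableP; split; first by apply: ge0_emeasurable_sum.
  under eq_integral do rewrite gee0_abs//.
  rewrite integral_nneseries//.
  apply: (@le_lt_trans _ _ 1%:E); last by rewrite ltry.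
  (* The bounds [1 / 2^(k+1)] sum to at most 1. *)
  apply: le_trans (@epsilon_trick0 R 1 xpredT ler01).
  apply: lee_nneseries => [k _ _|k _]; first exact: integral_ge0.
  exact: step.
apply: filterS (integrable_ae measurableT int_S) => x /(_ I) Sx.
suff : cvgn (series (telescope (a ^~ x))).
  rewrite telescopeK => /cvg_ex[l al]; apply/cvg_ex; exists (l + a 0%N x).
  have -> : a ^~ x = (fun n => (a n x - a 0%N x) + a 0%N x).
    by apply/funext => n; rewrite subrK.
  by apply: cvgD => //; exact: cvg_cst.
apply: normed_cvg.
apply: nondecreasing_is_cvgn.
  by apply: nondecreasing_series => n _ _; exact: normr_ge0.
exists (fine (\sum_(k <oo) D k x)%E) => _ [n _ <-].
rewrite -lee_fin fineK// /series /= -sumEFin.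
exact: (@nneseries_lim_ge _ (D ^~ x) xpredT).
Qed.

(** For [l > 0] the power is eventually [expR (p * ln (u n))], a continuous expression. For [l = 0]
    that formula breaks down, and [u n < e^(1/p)] gives the estimate directly. *)
Lemma cvg_powR {R : realType} (p : R) (u : nat -> R) (l : R) : 0 < p ->
  (forall n, 0 <= u n) -> u n @[n --> \oo] --> l ->
  u n `^ p @[n --> \oo] --> l `^ p.
Proof.
move=> p0 u0 ul.
have l0 : 0 <= l.
  rewrite -(cvg_lim _ ul)//; apply: limr_ge; last exact: nearW.
  by apply/cvg_ex; exists l.
have [l_eq0|l_gt0] := eqVneq l 0; last first.
  have {l_gt0}l0 : 0 < l by rewrite lt_def l_gt0.
  rewrite [X in _ --> X]/powR gt_eqF//.
  have lnul : ln (u n) @[n --> \oo] --> ln l.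
    by apply: continuous_cvg => //; exact: continuous_ln.
  apply: (@cvg_trans _ (expR (p * ln (u n)) @[n --> \oo])).
    apply: near_eq_cvg; near=> n.
    by rewrite /powR gt_eqF//; near: n; exact: (cvgr_gt l ul).
  apply: continuous_cvg; first exact: continuous_expR.
  by apply: cvgM => //; exact: cvg_cst.
rewrite l_eq0 powR0 ?gt_eqF//; apply/cvgr0Pnorm_lt => e e0.
have e1 : 0 < e `^ p^-1 by rewrite powR_gt0.
move: ul; rewrite l_eq0 => /cvgr0Pnorm_lt /(_ _ e1); apply: filterS => n.
rewrite ger0_norm// ger0_norm ?powR_ge0// => h.
have := @gt0_ltr_powR _ p p0 (u n) (e `^ p^-1).
rewrite !nnegrE => /(_ (u0 n) (ltW e1) h).
by rewrite -powRrM mulVf ?gt_eqF// powRr1 ?ltW.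
Unshelve. all: by end_near.
Qed.

Section LpComplete.
Context {R : realType}.
Implicit Types (p q M : R) (f : R -> R[i]).
Local Notation mu := (circle_prob R).

Lemma le_normLp p q f : 0 < p -> p <= q -> cmeasurable f ->
  (normLp p f <= normLp q f)%E.
Proof.
move=> p0 pq mf.
exact: (le_Lnorm_probability mu p0 pq (measurable_normc mf)).
Qed.

(** Raising to the powers [p] and [p^-1] is monotone on nonnegative extended reals. The equality of
    booleans serves as a rewriting rule between norms and integrals. *)
Lemma normLp_le p f M : 0 < p -> 0 <= M ->
  (normLp p f <= M%:E)%E = (\int[mu]_t (normc (f t) `^ p)%:E <= (M `^ p)%:E)%E.
Proof.
move=> p0 M0; rewrite -normLpE ?gt_eqF// -poweR_EFin.
have N0 := normLp_ge0 p f.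
apply/idP/idP => [h|].
  apply: gt0_ler_poweR => //;
    by rewrite ?in_itv/= ?leey ?andbT ?lee_fin ?(ltW p0).
move=> h; have pV0 : 0 <= p^-1 by rewrite invr_ge0 ltW.
have := @gt0_ler_poweR _ _ pV0 _ _ _ _ h.
rewrite -!poweRrM !mulfV ?gt_eqF// !poweRe1 ?lee_fin//; apply.
  by rewrite in_itv/= leey andbT poweR_ge0.
by rewrite in_itv/= leey andbT lee_fin powR_ge0.
Qed.

(** Fatou's lemma for the functions [|g j|^p], which converge to [|f|^p] almost everywhere. *)
Lemma normLp_fatou p (g : nat -> R -> R[i]) f M : 0 < p -> 0 <= M ->
  (forall j, cmeasurable (g j)) -> cmeasurable f ->
  {ae mu, forall t, normc (g j t) @[j --> \oo] --> normc (f t)} ->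
  (forall j, normLp p (g j) <= M%:E)%E -> (normLp p f <= M%:E)%E.
Proof.
move=> p0 M0 mg mf gf gM; rewrite normLp_le//.
have mpow (h : R -> R[i]) : cmeasurable h ->
    measurable_fun [set: R] (fun t => (normc (h t) `^ p)%:E).
  move=> mh; apply/measurable_EFinP.
  by apply: (measurableT_comp (measurable_powR p)); exact: measurable_normc.
have cg : {ae mu, forall t,
    (normc (g j t) `^ p)%:E @[j --> \oo] --> (normc (f t) `^ p)%:E}.
  apply: (circle_aeS gf) => t gt; apply: cvg_EFin; first exact: nearW.
  by apply: cvg_powR => // j; exact: normc_ge0.
have -> : (\int[mu]_t (normc (f t) `^ p)%:E)%E =
    (\int[mu]_t limn_einf (fun j => (normc (g j t) `^ p)%:E))%E.
  apply: ae_eq_integral => //; first exact: mpow.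
    (* The lower limit is the opposite of the upper limit of the opposite sequence, whose
       measurability is known. *)
    apply: (measurableT_comp (@oppe_measurable R _)).
    apply: measurable_fun_limn_esup => j.
    by apply: measurableT_comp => //; exact: mpow.
  apply: (circle_aeS cg) => t gt _.
  by have [->] := cvg_limn_einf_sup gt.
apply: le_trans (fatou _ _ _ _) _ => //.
- by move=> j; exact: mpow.
- by move=> j t _; rewrite lee_fin powR_ge0.
(* The lower limit is the limit of the infima over tails, and each infimum is at most the first term
   of its tail. *)
rewrite limn_einf_lim; apply: lime_le; first exact: is_cvg_einfs.
apply: nearW => n.
apply: (@le_trans _ _ (\int[mu]_t (normc (g n t) `^ p)%:E)%E).
  by apply: ereal_inf_lbound; exists n => /=.
by rewrite -normLp_le.
Qed.

(** On a probability space the L^1 norm is at most the L^p norm, so the real and imaginary parts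
    have summable L^1 steps and converge almost everywhere. *)
Lemma ae_cvg_of_Lp_steps p (h : nat -> R -> R[i]) : 1 <= p ->
  (forall k, cmeasurable (h k)) ->
  (forall k, (normLp p (fun t => (h k.+1 t - h k t)%R) <=
              (1 / (2 ^ k.+1)%:R)%:E)%E) ->
  exists2 f, cmeasurable f &
    {ae mu, forall t, normc (h k t - f t) @[k --> \oo] --> (0 : R)}.
Proof.
move=> p1 mh step.
(* [F] stands for [Re] or [Im]: it is compatible with subtraction and bounded by the modulus. *)
have ae_cvg (F : R[i] -> R) : {morph F : z w / z - w >-> z - w} ->
    (forall z, `|F z| <= normc z) ->
    (forall k, measurable_fun [set: R] (F \o h k)) ->
    {ae mu, forall t, cvgn (fun k => F (h k t))}.
  move=> FB Fle mF; apply: ae_is_cvgn_of_L1_steps => // k.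
  apply: le_trans (step k).
  apply: le_trans (le_normLp ltr01 p1 (cmeasurableB (mh _) (mh _))).
  rewrite /normLp Lnorm1; apply: ge0_le_integral => //.
  - apply/measurable_EFinP; apply: measurableT_comp => //.
    by apply: measurable_funB; exact: mF.
  - apply: measurableT_comp => //; apply/measurable_EFinP.
    apply: (@measurable_normc _ (fun t => h k.+1 t - h k t)).
    exact: cmeasurableB.
  - by move=> t _; rewrite lee_fin -FB ger0_norm ?normc_ge0.
have cRe : {ae mu, forall t, cvgn (fun k => Re (h k t))}.
  apply: ae_cvg => [z w|z|k]; first by rewrite complexReD complexReN.
    exact: normr_Re_le_normc.
  exact: (mh k).1.
have cIm : {ae mu, forall t, cvgn (fun k => Im (h k t))}.
  apply: ae_cvg => [z w|z|k]; first by rewrite complexImD complexImN.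
    exact: normr_Im_le_normc.
  exact: (mh k).2.
(* The upper limit is measurable everywhere, also at points of divergence, where its value is
   irrelevant; it is the limit at points of convergence. *)
pose lim_of (F : R[i] -> R) t := fine (limn_esup (fun k => (F (h k t))%:E)).
have mlim (F : R[i] -> R) : (forall k, measurable_fun [set: R] (F \o h k)) ->
    measurable_fun [set: R] (lim_of F).
  move=> mF; rewrite /lim_of; apply: measurableT_comp => //.
  by apply: measurable_fun_limn_esup => k; apply/measurable_EFinP; exact: mF.
have lim_ofE (F : R[i] -> R) t : cvgn (fun k => F (h k t)) ->
    F (h k t) @[k --> \oo] --> lim_of F t.
  move=> /cvg_ex[l Fl]; rewrite /lim_of.
  have /cvg_limn_einf_sup[_ ->//] : (F (h k t))%:E @[k --> \oo] --> l%:E.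
  by apply: cvg_EFin => //; exact: nearW.
exists (fun t => (lim_of Re t +i* lim_of Im t)%C).
  by split => /=; apply: mlim => k; [exact: (mh k).1|exact: (mh k).2].
apply: (circle_aeS2 cRe cIm) => t /lim_ofE cr /lim_ofE ci.
have sub0 (F : R[i] -> R) : F (h k t) @[k --> \oo] --> lim_of F t ->
    `|F (h k t) - lim_of F t| @[k --> \oo] --> (0 : R).
  move=> cF; rewrite -(normr0 R) -(subrr (lim_of F t)); apply: cvg_norm.
  by apply: cvgB => //; exact: cvg_cst.
apply: (@squeeze_cvgr _ _ _ _ (fun=> 0)
  (fun k => `|Re (h k t) - lim_of Re t| + `|Im (h k t) - lim_of Im t|)).
- apply: nearW => k; rewrite normc_ge0 /=.
  apply: le_trans (normc_le _) _.
  by rewrite complexReD complexImD complexReN complexImN.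
- exact: cvg_cst.
- by rewrite -[X in _ --> X]addr0; apply: cvgD; exact: sub0.
Qed.

(** Riesz-Fischer: a subsequence with steps at most [1 / 2^(k+1)] converges almost everywhere to
    some [f], and Fatou's lemma turns the Cauchy condition into convergence in norm to [f]. *)
Lemma Lp_complete p (h : nat -> R -> R[i]) : 1 <= p ->
  (forall n, Lp p (h n)) ->
  (forall e : R, 0 < e -> exists N : nat, forall m n,
     (N <= m)%N -> (N <= n)%N ->
     (normLp p (fun t => (h m t - h n t)%R) <= e%:E)%E) ->
  exists2 f, Lp p f &
    forall e : R, 0 < e -> exists N : nat, forall n, (N <= n)%N ->
     (normLp p (fun t => (h n t - f t)%R) <= e%:E)%E.
Proof.
move=> p1 Lh cauchy; have p0 : 0 < p by exact: lt_le_trans p1.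
have mh n := (Lh n).1.
have /choice[N HN] : forall k : nat, exists N : nat, forall m n,
    (N <= m)%N -> (N <= n)%N ->
    (normLp p (fun t => (h m t - h n t)%R) <= (1 / (2 ^ k.+1)%:R)%:E)%E.
  by move=> k; apply: cauchy; rewrite divr_gt0// ltr0n expn_gt0.
(* Summing the thresholds makes [phi] nondecreasing and at least [N k]; the summand [k] makes it at
   least [k], so that it passes every later threshold [N0]. *)
pose phi k := (k + \sum_(i < k.+1) N i)%N.
have phi_ge k : (N k <= phi k)%N by rewrite /phi big_ord_recr /= addnA leq_addl.
have phiS k : (phi k <= phi k.+1)%N.
  by rewrite /phi [X in (_ <= _ + X)%N]big_ord_recr /= leq_add// leq_addr.
have [f mf hf] : exists2 f, cmeasurable f &
    {ae mu, forall t, normc (h (phi k) t - f t) @[k --> \oo] --> (0 : R)}.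
  apply: (@ae_cvg_of_Lp_steps p) => // k; apply: HN; last exact: phi_ge.
  exact: leq_trans (phi_ge k) (phiS k).
have close (e : R) : 0 < e -> exists N : nat, forall n, (N <= n)%N ->
     (normLp p (fun t => (h n t - f t)%R) <= e%:E)%E.
  move=> e0; have [N0 HN0] := cauchy _ e0; exists N0 => n N0n.
  (* [n] is fixed and the other index runs along the subsequence, shifted by [N0] so that every term
     satisfies the Cauchy bound. *)
  apply: (@normLp_fatou p (fun j t => h n t - h (phi (j + N0)%N) t)) => //.
  - exact: ltW.
  - by move=> j; exact: cmeasurableB.
  - exact: cmeasurableB.
  - apply: (circle_aeS hf) => t ht.
    have {}ht : normc (h (phi (j + N0)%N) t - f t) @[j --> \oo] --> (0 : R).
      by have := ht; rewrite -(cvg_shiftn N0).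
    (* The reverse triangle inequality: the moduli converge because [h (phi (j + N0)) t] tends to
       [f t]. *)
    have bnd (j : nat) :
        `|normc (h n t - f t) - normc (h n t - h (phi (j + N0)%N) t)| <=
        normc (h (phi (j + N0)%N) t - f t).
      have tri (x y : R[i]) : normc x - normc y <= normc (x - y).
        by rewrite lerBlDr; apply: le_trans (le_normcD _ _); rewrite subrK.
      rewrite ler_norml lerNl opprB; apply/andP; split.
        apply: le_trans (tri _ _) _.
        rewrite -[leRHS]normcN (_ : - (h (phi (j + N0)%N) t - f t) =
          h n t - h (phi (j + N0)%N) t - (h n t - f t))//; ring.
      apply: le_trans (tri _ _) _.
      rewrite (_ : h n t - f t - (h n t - h (phi (j + N0)%N) t) =
        h (phi (j + N0)%N) t - f t)//; ring.
    apply/cvgrPdist_lt => e' e'0.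
    move/cvgr0Pnorm_lt: ht => /(_ _ e'0); apply: filterS => j.
    rewrite ger0_norm ?normc_ge0//; apply: le_lt_trans; exact: bnd.
  - move=> j; apply: HN0 => //; apply: leq_trans (leq_addr _ _).
    exact: leq_addl.
exists f => //; split => //.
have [n Hn] := close _ ltr01.
(* [f] is in L^p as the difference of [h n] and a function of norm at most 1. *)
have -> : f = fun t => h n t - (h n t - f t).
  by apply/funext => t; rewrite opprB addrC subrK.
apply: (LpB p1 (Lh n) _).2; split; first exact: cmeasurableB.
by apply: le_lt_trans (Hn n (leqnn n)) _; rewrite ltry.
Qed.

End LpComplete.

(** * Orthogonality in L^2 and decreasing sequences of closed subspaces *)

Section HilbertL2.
Context {R : realType}.
Implicit Types (f g v : R -> R[i]).
Local Notation mu := (circle_prob R).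

(** The squared L^2 norm as a real number, meaningful on [Lp 2], where the integral is finite.
    Pythagoras then becomes an identity between reals. *)
Definition sqnorm f : R := \int[mu]_t (normc (f t) ^+ 2).

Lemma Lp2_integrable_normcM f g : Lp 2 f -> Lp 2 g ->
  mu.-integrable [set: R] (fun t => (normc (f t) * normc (g t))%:E).
Proof.
move=> [mf f2] [mg g2]; rewrite normc_Lfun// in f2; rewrite normc_Lfun// in g2.
exact: (Lfun1_integrable mu _).1 (Lfun2_mul_Lfun1 f2 g2).
Qed.

Lemma Lp2_integrable_sqr f : Lp 2 f ->
  mu.-integrable [set: R] (fun t => (normc (f t) ^+ 2)%:E).
Proof. by move=> Lf; exact: Lp2_integrable_normcM. Qed.

Lemma sqnorm_ge0 f : 0 <= sqnorm f.
Proof. by apply: Rintegral_ge0 => t _; exact: sqr_ge0. Qed.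

Lemma normLp2_le f (e : R) : Lp 2 f -> 0 <= e ->
  (normLp 2 f <= e%:E)%E = (sqnorm f <= e ^+ 2).
Proof.
move=> Lf e0; rewrite normLp_le// powR_mulrn//.
under eq_integral do rewrite powR_mulrn ?normc_ge0//.
rewrite -[X in (X <= _)%E]fineK ?lee_fin//.
exact: (integrable_fin_num measurableT (Lp2_integrable_sqr Lf)).
Qed.

Lemma Lp2_integrable_Re_Im f g : Lp 2 f -> Lp 2 g ->
  mu.-integrable [set: R] (fun t => (Re (f t * conjc (g t)))%:E) /\
  mu.-integrable [set: R] (fun t => (Im (f t * conjc (g t)))%:E).
Proof.
move=> Lf Lg; have [mr mi] := cmeasurableM Lf.1 (cmeasurableJ Lg.1).
have normcJ z : normc (conjc z) = normc z :> R.
  by case: z => a b /=; rewrite sqrrN.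
split; apply: (le_integrable measurableT _ _ (Lp2_integrable_normcM Lf Lg)).
- exact/measurable_EFinP.
- move=> t _; rewrite lee_fin [leRHS]ger0_norm ?mulr_ge0 ?normc_ge0//.
  apply: le_trans (normr_Re_le_normc _) _.
  by rewrite ComplexField.Normc.normcM normcJ.
- exact/measurable_EFinP.
- move=> t _; rewrite lee_fin [leRHS]ger0_norm ?mulr_ge0 ?normc_ge0//.
  apply: le_trans (normr_Im_le_normc _) _.
  by rewrite ComplexField.Normc.normcM normcJ.
Qed.

Lemma inner_prodBl f g v : Lp 2 f -> Lp 2 g -> Lp 2 v ->
  inner_prod (fun t => f t - g t) v = inner_prod f v - inner_prod g v.
Proof.
move=> Lf Lg Lv; have [fr fi] := Lp2_integrable_Re_Im Lf Lv.
have [gr gi] := Lp2_integrable_Re_Im Lg Lv.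
rewrite /inner_prod /cintegral; congr (_ +i* _)%C.
  rewrite -RintegralB//; apply: eq_Rintegral => t _.
  by rewrite mulrBl complexReD complexReN.
rewrite -RintegralB//; apply: eq_Rintegral => t _.
by rewrite mulrBl complexImD complexImN.
Qed.

Lemma sqnormD f g : Lp 2 f -> Lp 2 g -> inner_prod f g = 0 ->
  sqnorm (fun t => f t + g t) = sqnorm f + sqnorm g.
Proof.
move=> Lf Lg [fg0 _]; have [fgr _] := Lp2_integrable_Re_Im Lf Lg.
have f2 := Lp2_integrable_sqr Lf; have g2 := Lp2_integrable_sqr Lg.
rewrite /sqnorm -RintegralD//.
(* The cross term [2 Re (f conj g)] is brought in as twice the vanishing real part of the inner
   product. *)
rewrite -[RHS]addr0 -(mulr0 2) -fg0 -RintegralZl// -RintegralD//.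
- apply: eq_Rintegral => t _.
  rewrite !sqr_normcE complexReM complexReJ complexImJ complexReD complexImD.
  by ring.
- rewrite (_ : _ \o _ = (EFin \o (fun t => normc (f t) ^+ 2)) \+
    (EFin \o (fun t => normc (g t) ^+ 2)))//.
  exact: integrableD.
- exact: (integrableZl measurableT 2 fgr).
Qed.

Lemma sqnormBC f g : sqnorm (fun t => f t - g t) = sqnorm (fun t => g t - f t).
Proof. by apply: eq_Rintegral => t _; rewrite -[in LHS]opprB normcN. Qed.

(** By Pythagoras the squared norms of the [x n] decrease, and their differences are the squared
    distances, so [x n] is Cauchy. Its limit [z] lies in every [V n]. It need not be identified with
    [y]: as [y] is the projection onto the intersection, [x n] is at least as close to [y] as to
    [z]. *)
Lemma projections_decreasing_cvg (V : nat -> set (R -> R[i]))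
    (x : nat -> R -> R[i]) g y :
  (forall n, V n `<=` Lp 2) ->
  (forall n f, Lp 2 f -> (forall e : R, 0 < e ->
     exists2 v, V n v & (normLp 2 (fun t => (f t - v t)%R) < e%:E)%E) ->
   V n f) ->
  (forall n f v, V n f -> V n v -> V n (fun t => f t - v t)) ->
  (forall m n, (m <= n)%N -> V n `<=` V m) ->
  Lp 2 g ->
  (forall n, V n (x n)) ->
  (forall n v, V n v -> inner_prod (fun t => g t - x n t) v = 0) ->
  (\bigcap_n V n) y ->
  (forall v, (\bigcap_n V n) v -> inner_prod (fun t => g t - y t) v = 0) ->
  forall e : R, 0 < e -> exists N : nat, forall n, (N <= n)%N ->
    (normLp 2 (fun t => (x n t - y t)%R) <= e%:E)%E.
Proof.
move=> VL Vclosed VB Vdecr Lg Vx gx Vy gy.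
have Lx n : Lp 2 (x n) by exact: VL (Vx n).
have Ly : Lp 2 y by exact: VL (Vy 0%N I).
have LB f v : Lp 2 f -> Lp 2 v -> Lp 2 (fun t => f t - v t).
  by apply: LpB; rewrite ler1n.
have sqx m n : (m <= n)%N ->
    sqnorm (x m) = sqnorm (fun t => x m t - x n t) + sqnorm (x n).
  move=> mn; rewrite -sqnormD//; [|exact: LB|].
    by apply: eq_Rintegral => t _; rewrite subrK.
  (* Both [g - x n] and [g - x m] are orthogonal to [x n], which belongs to [V n] and hence to
     [V m]. *)
  have -> : (fun t => x m t - x n t) =
      (fun t => (g t - x n t) - (g t - x m t)).
    by apply/funext => t; ring.
  rewrite inner_prodBl//; [|exact: LB|exact: LB].
  by rewrite gx// gx ?subr0//; exact: Vdecr (Vx n).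
have xdecr : nonincreasing_seq (fun n => sqnorm (x n)).
  by move=> m n mn /=; rewrite (sqx _ _ mn) lerDr sqnorm_ge0.
have xcvg : cvgn (fun n => sqnorm (x n)).
  apply: nonincreasing_is_cvgn => //.
  by exists 0 => _ [n _ <-]; exact: sqnorm_ge0.
set l := limn (fun n => sqnorm (x n)) in xcvg.
have cauchy : forall e : R, 0 < e -> exists N : nat,
    forall m n, (N <= m)%N -> (N <= n)%N ->
    (normLp 2 (fun t => (x m t - x n t)%R) <= e%:E)%E.
  move=> e e0; have e20 : 0 < e ^+ 2 by rewrite exprn_gt0.
  have lx n : l <= sqnorm (x n) by exact: nonincreasing_cvgn_ge.
  have [N _ HN] : \forall n \near \oo, sqnorm (x n) < l + e ^+ 2.
    by apply: (cvgr_lt l xcvg); rewrite ltrDl.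
  exists N => m n Nm Nn; rewrite normLp2_le//; [|exact: LB|exact: ltW].
  wlog mn : m n Nm Nn / (m <= n)%N.
    (* For [m <= n] the squared distance is [sqnorm (x m) - sqnorm (x n)], where the first term is
       below [l + e^2] and the second at least [l]. *)
    by move=> H; have [/H->//|/ltnW/H] := leqP m n; rewrite sqnormBC; exact.
  have := HN m Nm; have := lx n; rewrite /= (sqx _ _ mn); lra.
have [|z Lz xz] := Lp_complete _ Lx cauchy; first by rewrite ler1n.
have Vz : (\bigcap_n V n) z.
  move=> n _; apply: Vclosed => // e e0.
  (* Half of [e] turns the large inequality of the limit into the strict one of the closedness
     condition. The index [maxn n N] gives an approximant inside [V n]. *)
  have e20 : 0 < e / 2 by rewrite divr_gt0.
  have [N HN] := xz _ e20; exists (x (maxn n N)).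
    by apply: Vdecr (Vx _); exact: leq_maxl.
  rewrite normLp_subC; apply: le_lt_trans (HN _ (leq_maxr _ _)) _.
  by rewrite lte_fin ltr_pdivrMr// ltr_pMr// ltr1n.
move=> e e0; have [N HN] := xz _ e0; exists N => n /HN.
rewrite !normLp2_le ?(ltW e0)//; [|exact: LB|exact: LB].
apply: le_trans.
(* [x n - y] is orthogonal to [y - z], which lies in the intersection *)
have -> : sqnorm (fun t => x n t - z t) =
    sqnorm (fun t => x n t - y t) + sqnorm (fun t => y t - z t).
  rewrite -sqnormD; [|exact: LB|exact: LB|].
    by apply: eq_Rintegral => t _; congr (normc _ ^+ 2); ring.
  have -> : (fun t => x n t - y t) =
      (fun t => (g t - y t) - (g t - x n t)).
    by apply/funext => t; ring.
  have Vyz k : V k (fun t => y t - z t) by apply: VB; [exact: Vy|exact: Vz].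
  rewrite inner_prodBl; [|exact: LB|exact: LB|exact: LB].
  by rewrite gx// gy ?subr0// => k _.
by rewrite lerDl sqnorm_ge0.
Qed.

End HilbertL2.

(** * Density of bounded functions in L^p *)

Section Truncation.
Context {R : realType}.
Implicit Types (p : R) (f g : R -> R[i]).
Local Notation mu := (circle_prob R).

(** [f] is replaced by 0 where its modulus exceeds [k]. The error has p-th power dominated by
    [|f|^p] and vanishes at each point once [k] is at least [|f t|], so dominated convergence
    applies. *)
Lemma Lp_bounded_approx p f (e : R) : 1 <= p -> Lp p f -> 0 < e ->
  exists g, [/\ cmeasurable g, exists M : R, forall t, normc (g t) <= M &
    (normLp p (fun t => (f t - g t)%R) <= e%:E)%E].
Proof.
move=> p1 [mf fp] e0; have p0 : 0 < p by exact: lt_le_trans p1.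
pose g (k : nat) t := if normc (f t) <= k%:R then f t else 0.
have mg k : cmeasurable (g k).
  have mA : measurable_fun [set: R] (fun t => normc (f t) <= k%:R).
    by apply: measurable_fun_ler => //; exact: measurable_normc.
  split.
    rewrite (_ : (fun t => _) =
        fun t => if normc (f t) <= k%:R then Re (f t) else 0); last first.
      by apply/funext => t; rewrite /g; case: ifP.
    by apply: measurable_fun_ifT => //; exact: mf.1.
  rewrite (_ : (fun t => _) =
      fun t => if normc (f t) <= k%:R then Im (f t) else 0); last first.
    by apply/funext => t; rewrite /g; case: ifP.
  by apply: measurable_fun_ifT => //; exact: mf.2.
have fg_le k t : normc (f t - g k t) <= normc (f t).
  rewrite /g; case: ifP => _; last by rewrite subr0.
  by rewrite subrr ComplexField.Normc.normc0 normc_ge0.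
have mpow (h : R -> R[i]) : cmeasurable h ->
    measurable_fun [set: R] (fun t => (normc (h t) `^ p)%:E).
  move=> mh; apply/measurable_EFinP.
  by apply: (measurableT_comp (measurable_powR p)); exact: measurable_normc.
have int_f : mu.-integrable [set: R] (fun t => (normc (f t) `^ p)%:E).
  apply/integrableP; split; first exact: mpow.
  under eq_integral do rewrite gee0_abs ?lee_fin ?powR_ge0//.
  by rewrite -normLpE ?gt_eqF// poweR_lty.
have fg_cvg : {ae mu, forall t, [set: R] t ->
    (normc (f t - g k t) `^ p)%:E @[k --> \oo] --> 0%E}.
  apply/aeW => t _; apply: cvg_near_cst; near=> k.
  have fk : normc (f t) <= k%:R by near: k; exact: nbhs_infty_ger.
  by rewrite /g fk subrr ComplexField.Normc.normc0 powR0// gt_eqF.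
have fg_dom : {ae mu, forall t (k : nat), [set: R] t ->
    (`|(normc (f t - g k t) `^ p)%:E| <= (normc (f t) `^ p)%:E)%E}.
  apply/aeW => t k _; rewrite gee0_abs ?lee_fin ?powR_ge0//.
  by rewrite ge0_ler_powR ?nnegrE ?normc_ge0 ?(ltW p0).
have [_ _] := @dominated_convergence _ _ _ mu [set: R] measurableT
  (fun k t => (normc (f t - g k t) `^ p)%:E) (cst 0%E)
  (fun t => (normc (f t) `^ p)%:E)
  (fun k => mpow _ (cmeasurableB mf (mg k))) (measurable_cst _)
  fg_cvg int_f fg_dom.
rewrite integral0 => /fine_cvgP[fin_int].
move=> /cvgr0Pnorm_le /(_ (e `^ p) (powR_gt0 _ e0)) small.
have [k [fink smallk]] : exists k : nat,
    ((\int[mu]_t (normc (f t - g k t) `^ p)%:E)%E \is a fin_num) /\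
    `|fine (\int[mu]_t (normc (f t - g k t) `^ p)%:E)%E| <= e `^ p.
  by have [k ?] := filter_ex (filterI fin_int small); exists k.
exists (g k); split => //.
  exists k%:R => t; rewrite /g; case: ifP => //.
  by rewrite ComplexField.Normc.normc0 ler0n.
rewrite normLp_le ?(ltW e0)// -(fineK fink) lee_fin.
exact: le_trans (ler_norm _) smallk.
Unshelve. all: by end_near.
Qed.

End Truncation.

(** * Bounds and orthogonality for the operators attached to invariant subspaces *)

Section AssociatedProjection.
Context {R : realType}.
Implicit Types (p : R) (f g v u : R -> R[i]) (V : set (R -> R[i])).
Local Notation mu := (circle_prob R).

Lemma ae_eq_cintegral f g : cmeasurable f -> cmeasurable g ->
  {ae mu, forall t, f t = g t} -> cintegral f = cintegral g.
Proof.
move=> [fr fi] [gr gi] fg; rewrite /cintegral /Rintegral; congr (_ +i* _)%C.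
  congr fine; apply: ae_eq_integral => //; try exact/measurable_EFinP.
  by apply: (circle_aeS fg) => t /= -> _.
congr fine; apply: ae_eq_integral => //; try exact/measurable_EFinP.
by apply: (circle_aeS fg) => t /= -> _.
Qed.

Lemma cintegral0 : cintegral (fun _ : R => 0) = 0.
Proof. by rewrite /cintegral /Rintegral /= integral0. Qed.

Lemma inner_fun_normc u : inner_fun u ->
  cmeasurable u /\ {ae mu, forall t, normc (u t) = 1}.
Proof.
move=> [mu_ [F [_ _ _ u1]]]; split => //.
by apply: (circle_aeS u1) => t; exact: normc_normr.
Qed.

Lemma unimodularV u : cmeasurable u -> {ae mu, forall t, normc (u t) = 1} ->
  cmeasurable (fun t => (u t)^-1) /\ {ae mu, forall t, normc (u t)^-1 = 1}.
Proof.
move=> mu_ u1; split; first exact: cmeasurableV.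
by apply: (circle_aeS u1) => t ut; rewrite ComplexField.Normc.normcV ut invr1.
Qed.

Context (H : (R -> R[i]) -> R -> R[i]) (Hriesz : riesz_projection H).

(** The bound on differences comes from the norm bound at [f - g]; since linearity of [H] holds only
    almost everywhere, [H f - H g] and [H (f - g)] are compared through their norms. *)
Lemma riesz_projection_Lipschitz p : 1 < p -> exists2 M : R, 0 <= M &
  forall f, Lp p f -> [/\ Lp p (H f),
    (normLp p (H f) <= M%:E * normLp p f)%E &
    forall g, Lp p g ->
      (normLp p (fun t => (H f t - H g t)%R) <=
       M%:E * normLp p (fun t => (f t - g t)%R))%E].
Proof.
move=> p1; have p0 : 0 < p by exact: lt_trans p1.
have [_ Hlin Hbnd] := Hriesz; have [M HM] := Hbnd p p1.
have LH f : Lp p f -> Lp p (H f) by move=> /HM[[]].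
(* The constant provided by the hypothesis has no prescribed sign; its maximum with 0 is nonnegative
   and still a bound. *)
have leM f : (M%:E * normLp p f <= (Num.max M 0)%:E * normLp p f)%E.
  by rewrite lee_wpmul2r ?normLp_ge0// lee_fin le_max lexx.
exists (Num.max M 0); first by rewrite le_max lexx orbT.
move=> f Lf; split; first exact: LH.
  exact: le_trans (HM f Lf).2 (leM f).
move=> g Lg; have Lfg := LpB (ltW p1) Lf Lg.
apply: le_trans (leM _).
apply: le_trans (HM _ Lfg).2.
rewrite le_eqVlt; apply/orP; left; apply/eqP.
apply: ae_eq_normLp => //.
- by apply: cmeasurableB; [case: (LH f Lf)|case: (LH g Lg)].
- by case: (LH _ Lfg).
have := Hlin p (-1) g f p1 Lg Lf.
rewrite (_ : (fun s => -1 * g s + f s) = fun t => f t - g t); last first.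
  by apply/funext => t; rewrite mulN1r addrC.
by move=> e; apply: (circle_aeS e) => t ->; rewrite mulN1r addrC.
Qed.

(** [M] is the constant of the Riesz projection, chosen before [V] and [P]: multiplications by [u]
    and [u^-1] are isometries of L^p. One constant thus serves all the [P n] and [Pinf]. *)
Lemma associated_projection_Lipschitz p : 1 < p -> exists2 M : R, 0 <= M &
  forall V P, associated_projection H V P ->
  forall f, Lp p f -> [/\ Lp p (P f),
    (normLp p (P f) <= M%:E * normLp p f)%E &
    forall g, Lp p g ->
      (normLp p (fun t => (P f t - P g t)%R) <=
       M%:E * normLp p (fun t => (f t - g t)%R))%E].
Proof.
move=> p1; have p0 : 0 < p by exact: lt_trans p1.
have [M M0 HM] := riesz_projection_Lipschitz p1; exists M => // V P.
move=> [[_ P0]|[u [/inner_fun_normc[mu_ u1] _ Pu]]] f Lf.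
  have L0 : Lp p (fun=> 0 : R[i]).
    apply: (@Lp_bounded _ p _ 0 (ltW p1)); first exact: cmeasurable_cst.
    by move=> t; rewrite ComplexField.Normc.normc0.
  have norm0 : normLp p (fun=> 0 : R[i]) = 0%E.
    apply/eqP; rewrite eq_le normLp_ge0 andbT normLp_le//.
    under eq_integral do rewrite ComplexField.Normc.normc0.
    by rewrite powR0 ?gt_eqF// integral0.
  split; rewrite ?P0// ?norm0; first by rewrite mule_ge0 ?normLp_ge0.
  move=> g _; rewrite P0.
  rewrite (_ : (fun t => _) = fun=> 0); last first.
    by apply/funext => t; rewrite subr0.
  by rewrite norm0 mule_ge0 ?normLp_ge0.
have [mV V1] := unimodularV mu_ u1.
have scaleV h : Lp p h ->
    Lp p (fun t => (u t)^-1 * h t) /\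
    normLp p (fun t => (u t)^-1 * h t) = normLp p h.
  exact: Lp_unimodularM.
have scale h : Lp p h ->
    Lp p (fun t => u t * h t) /\ normLp p (fun t => u t * h t) = normLp p h.
  exact: Lp_unimodularM.
have [Luf nuf] := scaleV _ Lf; have [LHf nHf HfB] := HM _ Luf.
rewrite Pu /inner_projection; split; first exact: (scale _ LHf).1.
  by rewrite (scale _ LHf).2 -nuf.
move=> g Lg; rewrite Pu; have [Lug nug] := scaleV _ Lg.
have LHg : Lp p (H (fun s => (u s)^-1 * g s)) by have [] := HM _ Lug.
rewrite (_ : (fun t => _) = fun t => u t * (H (fun s => (u s)^-1 * f s) t -
    H (fun s => (u s)^-1 * g s) t)); last first.
  by apply/funext => t; rewrite mulrBr.
rewrite (scale _ (LpB (ltW p1) LHf LHg)).2.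
apply: le_trans (HfB _ Lug) _.
rewrite (_ : (fun t => _) = fun t => (u t)^-1 * (f t - g t)); last first.
  by apply/funext => t; rewrite mulrBr.
by rewrite (scaleV _ (LpB (ltW p1) Lf Lg)).2.
Qed.

(** Since [conj u = u^-1] almost everywhere, pairing [g - u H(u^-1 g)] with [u k] amounts to pairing
    [u^-1 g - H(u^-1 g)] with [k] in H^2, which gives 0 by the defining property of [H]. *)
Lemma associated_projection_orthogonal V P g :
  associated_projection H V P -> Lp 2 g ->
  V (P g) /\ forall v, V v -> inner_prod (fun t => g t - P g t) v = 0.
Proof.
move=> HP Lg; have mg := Lg.1.
case: HP => [[-> P0]|[u [/inner_fun_normc[mu_ u1] -> Pu]]].
  split; first by rewrite P0; split; [exact: cmeasurable_cst|exact: aeW].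
  move=> v [mv v0]; rewrite -cintegral0; apply: ae_eq_cintegral.
  - apply: cmeasurableM; last exact: cmeasurableJ.
    by apply: cmeasurableB => //; rewrite P0; exact: cmeasurable_cst.
  - exact: cmeasurable_cst.
  - by apply: (circle_aeS v0) => t ->; rewrite rmorph0 mulr0.
have [mV V1] := unimodularV mu_ u1.
have [Hproj _ _] := Hriesz.
have two0 : 0 < 2 :> R by [].
have [LVg _] := Lp_unimodularM two0 mV V1 Lg.
have [HpH orth] := Hproj _ LVg.
rewrite Pu /inner_projection; set h := H _ in HpH orth *.
have mh : cmeasurable h by case: HpH => -[].
have muh := cmeasurableM mu_ mh.
split; first by split => //; exists h => //; exact: aeW.
move=> v [mv [k Hk vk]]; have mk : cmeasurable k by case: Hk => -[].
rewrite -(orth k Hk); apply: ae_eq_cintegral.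
- by apply: cmeasurableM; [exact: cmeasurableB|exact: cmeasurableJ].
- apply: cmeasurableM; last exact: cmeasurableJ.
  by apply: cmeasurableB => //; exact: cmeasurableM.
apply: (circle_aeS2 u1 vk) => t ut ->.
have u0 : u t != 0.
  apply: contra_eqN ut => /eqP ->.
  by rewrite ComplexField.Normc.normc0 eq_sym oner_eq0.
rewrite rmorphM /= (conj_invc ut) mulrA; congr (_ * _).
by field.
Qed.

End AssociatedProjection.

(** * From convergence in L^2 to convergence in L^p *)

Section Interpolation.
Context {R : realType}.
Implicit Types (p e C : R) (x : nat -> R -> R[i]).
Local Notation mu := (circle_prob R).

Lemma normLp_cvg_interpolation p C x : 1 < p -> 0 <= C ->
  (forall n, cmeasurable (x n)) ->
  (forall n, normLp (2 * (p - 1)) (x n) <= C%:E)%E ->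
  (forall e, 0 < e -> exists N : nat, forall n, (N <= n)%N ->
     (normLp 2 (x n) <= e%:E)%E) ->
  forall e, 0 < e -> exists N : nat, forall n, (N <= n)%N ->
    (normLp p (x n) <= e%:E)%E.
Proof.
move=> p1 C0 mx xC x2 e e0; have p0 : 0 < p by exact: lt_trans p1.
have q0 : 0 <= p - 1 by rewrite subr_ge0 ltW.
(* The added 1 keeps the divisor positive, even when [C = 0]. The L^2 threshold [e^p / K] then makes
   the product with [C^(p-1)] at most [e^p]. *)
pose K := C `^ (p - 1) + 1.
have K0 : 0 < K by rewrite ltr_wpDl ?powR_ge0.
have d0 : 0 < e `^ p / K by rewrite divr_gt0 ?powR_gt0.
have [N HN] := x2 _ d0; exists N => n /HN xn.
rewrite normLp_le ?(ltW e0)// -normLpE ?gt_eqF//.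
apply: le_trans (@Lnorm_interpolation _ _ _ mu p (normc \o x n) p1 _) _.
  exact: measurable_normc.
apply: (@le_trans _ _ ((e `^ p / K)%:E * (C `^ (p - 1))%:E)%E).
  apply: lee_pmul; [exact: Lnorm_ge0|exact: poweR_ge0|exact: xn|].
  rewrite -poweR_EFin; apply: gt0_ler_poweR => //; last exact: xC.
    by rewrite in_itv/= leey andbT Lnorm_ge0.
  by rewrite in_itv/= leey andbT lee_fin.
rewrite -EFinM lee_fin -mulrA ler_piMr ?powR_ge0// ler_pdivrMl// mulr1.
by rewrite /K lerDl.
Qed.

End Interpolation.

Lemma cvge0_of_le {R : realType} (u : nat -> \bar R) : (forall n, 0 <= u n)%E ->
  (forall e : R, 0 < e -> exists N : nat, forall n, (N <= n)%N ->
     (u n <= e%:E)%E) ->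
  u n @[n --> \oo] --> 0%E.
Proof.
move=> u0 small; apply/fine_cvgP; split.
  have [N HN] := small _ ltr01; exists N => // n /= /HN un.
  by rewrite ge0_fin_numE// (le_lt_trans un)// ltry.
apply/cvgr0Pnorm_le => e e0; have [N HN] := small _ e0.
exists N => // n /= /HN un.
rewrite ger0_norm ?fine_ge0// -lee_fin fineK//.
by rewrite ge0_fin_numE// (le_lt_trans un)// ltry.
Qed.

(** * Convergence of the projections in L^2, on bounded functions, and on L^p *)

Section DecreasingProjections.
Context {R : realType} (H : (R -> R[i]) -> R -> R[i]).
Context (Hriesz : riesz_projection H) (V : nat -> set (R -> R[i])).
Context (Vinv : forall n, invariant_subspace (V n)).
Context (Vdecr : forall m n, (m <= n)%N -> V n `<=` V m).
Context (P : nat -> (R -> R[i]) -> R -> R[i]).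
Context (HP : forall n, associated_projection H (V n) (P n)).
Context (Pinf : (R -> R[i]) -> R -> R[i]).
Context (HPinf : associated_projection H (\bigcap_n V n) Pinf).

Lemma projections_cvg_L2 g : Lp 2 g ->
  forall e : R, 0 < e -> exists N : nat, forall n, (N <= n)%N ->
    (normLp 2 (fun t => (P n g t - Pinf g t)%R) <= e%:E)%E.
Proof.
move=> Lg; have orth n := associated_projection_orthogonal Hriesz (HP n) Lg.
have [Vinfg orthinf] := associated_projection_orthogonal Hriesz HPinf Lg.
apply: (projections_decreasing_cvg _ _ _ Vdecr Lg) => //.
- by move=> n f Vf; have [VHp _ _ _] := Vinv n; case: (VHp f Vf).
- by move=> n; case: (Vinv n).
- move=> n f v Vf Vv; have [_ [_ Vlin] _ _] := Vinv n.
  (* Stability under subtraction is linearity with scalar -1. *)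
  have := Vlin (-1) v f Vv Vf.
  rewrite (_ : (fun t => _) = fun t => f t - v t)//.
  by apply/funext => t; rewrite mulN1r addrC.
- by move=> n; case: (orth n).
- by move=> n; case: (orth n).
Qed.

Lemma projections_cvg_bounded p g (K : R) : 1 < p -> cmeasurable g ->
  (forall t, normc (g t) <= K) ->
  forall e : R, 0 < e -> exists N : nat, forall n, (N <= n)%N ->
    (normLp p (fun t => (P n g t - Pinf g t)%R) <= e%:E)%E.
Proof.
move=> p1 mg gK; have p0 : 0 < p by exact: lt_trans p1.
have Lg q : 1 < q -> Lp q g.
  by move=> q1; apply: Lp_bounded gK => //; exact: ltW.
have cvg2 := projections_cvg_L2 (Lg 2 (ltr1n _ 2)).
have mP n : cmeasurable (fun t => P n g t - Pinf g t).
  have [M _ HM] := associated_projection_Lipschitz Hriesz p1.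
  have [[mPn _] _ _] := HM _ _ (HP n) g (Lg p p1).
  have [[mPi _] _ _] := HM _ _ HPinf g (Lg p p1).
  exact: cmeasurableB.
(* For [p <= 2] the L^p norm is at most the L^2 norm; for [p > 2] interpolation needs a bound at
   exponent [2 (p - 1)], which exceeds 1, so the uniform operator bound is available there. *)
have [p2|p2] := leP p 2.
  move=> e /cvg2[N HN]; exists N => n /HN; apply: le_trans.
  exact: le_normLp.
have q1 : 1 < 2 * (p - 1) by lra.
have [M M0 HM] := associated_projection_Lipschitz Hriesz q1.
have [_ gq] := Lg _ q1.
have gqfin : normLp (2 * (p - 1)) g \is a fin_num.
  by rewrite ge0_fin_numE ?normLp_ge0.
pose C := M * fine (normLp (2 * (p - 1)) g).
have C0 : 0 <= C by rewrite mulr_ge0// fine_ge0 ?normLp_ge0.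
(* [C] bounds [P n g] and [Pinf g] separately, so [C + C] bounds their difference for every [n]. *)
apply: (@normLp_cvg_interpolation _ p (C + C)) => //; first by rewrite addr_ge0.
move=> n.
have [LPn Pn _] := HM _ _ (HP n) g (Lg _ q1).
have [LPi Pi _] := HM _ _ HPinf g (Lg _ q1).
have [mN nN] := LpN LPi.
have CE : C%:E = (M%:E * normLp (2 * (p - 1)) g)%E by rewrite /C EFinM fineK.
apply: le_trans (normLpD (ltW q1) LPn.1 mN) _.
rewrite EFinD CE; apply: leeD => //; apply: le_trans Pi.
rewrite /normLp le_eqVlt; apply/orP; left; apply/eqP; congr Lnorm.
by apply/funext => t; rewrite normcN.
Qed.

Lemma projections_cvg p f : 1 < p -> Lp p f ->
  forall e : R, 0 < e -> exists N : nat, forall n, (N <= n)%N ->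
    (normLp p (fun t => (P n f t - Pinf f t)%R) <= e%:E)%E.
Proof.
move=> p1 Lf e e0; have [M M0 HM] := associated_projection_Lipschitz Hriesz p1.
have e3 : 0 < e / 3 by rewrite divr_gt0.
have M1 : 0 < M + 1 by rewrite ltr_wpDl.
(* The approximation of [f] by [g] within [d] costs at most [M d <= e / 3] after any of the
   operators; dividing by [M + 1] avoids a zero divisor. *)
pose d := e / 3 / (M + 1).
have d0 : 0 < d by rewrite divr_gt0.
have Md : M * d <= e / 3.
  by rewrite mulrA ler_pdivrMr// mulrC ler_wpM2l ?(ltW e3)// lerDl.
have [g [mg [K gK] fg]] := Lp_bounded_approx (ltW p1) Lf d0.
have Lg : Lp p g by exact: Lp_bounded (ltW p1) mg gK.
have [N HN] := projections_cvg_bounded p1 mg gK e3.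
exists N => n /HN ng.
have close W Q : associated_projection H W Q ->
    cmeasurable (Q f) /\ cmeasurable (Q g) /\
    (normLp p (fun t => (Q f t - Q g t)%R) <= (e / 3)%:E)%E.
  move=> /HM HQ; have [[mQf _] _ /(_ g Lg) Qfg] := HQ f Lf.
  have [[mQg _] _ _] := HQ g Lg; split => //; split => //.
  apply: le_trans Qfg _; apply: le_trans (_ : _ <= (M * d)%:E)%E _.
    by rewrite EFinM lee_wpmul2l.
  by rewrite lee_fin.
have [mPf [mPg Pfg]] := close _ _ (HP n).
have [mQf [mQg Qfg]] := close _ _ HPinf.
apply: le_trans (normLp_sub_le (ltW p1) mPf mPg mQf) _.
(* One third each for [P n f] against [P n g], [P n g] against [Pinf g], and [Pinf g] against
   [Pinf f]. *)
have -> : e = e / 3 + (e / 3 + e / 3) by field.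
rewrite EFinD; apply: leeD => //.
apply: le_trans (normLp_sub_le (ltW p1) mPg mQg mQf) _.
by rewrite EFinD; apply: leeD => //; rewrite normLp_subC.
Qed.

End DecreasingProjections.

Theorem theorem1 (R : realType)
    (H : (R -> R[i]) -> R -> R[i]) (Hriesz : riesz_projection H)
    (V : nat -> set (R -> R[i]))
    (Vinv : forall n, invariant_subspace (V n))
    (V0 : V 0%N = Hp 2)
    (Vdecr : forall m n, (m <= n)%N -> V n `<=` V m)
    (P : nat -> (R -> R[i]) -> R -> R[i])
    (HP : forall n, associated_projection H (V n) (P n))
    (Pinf : (R -> R[i]) -> R -> R[i])
    (HPinf : associated_projection H (\bigcap_n V n) Pinf)
    (p : R) (hp : 1 < p) (f : R -> R[i]) (hf : Hp p f) :
  normLp p (fun t => P n f t - Pinf f t) @[n --> \oo] --> 0%E.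
Proof.
apply: cvge0_of_le => [n|]; first exact: normLp_ge0.
exact: (projections_cvg Hriesz Vinv Vdecr HP HPinf hp hf.1).
Qed.
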